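(* Let $\kappa<\mathfrak{H}$ be a cardinal and for each $s\in\kappa^{<\omega}$ let $Q_s\subseteq(\omega)^\omega$. If all the sets $Q_s$ are completely dual-Ramsey, then the set $$\mathcal{A}_\kappa\{Q_s:s\in\kappa^{<\omega}\}:=\bigcup_{f\in\kappa^\omega}\bigcap_{n\in\omega}Q_{\bar f(n)}$$ is completely dual-Ramsey, where $\bar f(n)=\langle f(0),\dots,f(n-1)\rangle$.
   Context: A partition of $\omega$ is a set of nonempty pairwise disjoint subsets (blocks) of $\omega$ whose union is $\omega$; $(\omega)^\omega$ is the set of partitions with infinitely many blocks. A partial partition is a set of nonempty pairwise disjoint subsets of $\omega$, with domain the union of its blocks; $(\mathbb{N})$ denotes the set of partial partitions whose domain is a natural number $n=\{0,\dots,n-1\}$. For partial partitions $X_1,X_2$, $X_1\sqsubseteq X_2$ means: for every block $b$ of $X_1$, $b\cap\mathrm{dom}(X_2)$ is a union of sets $b'\cap\mathrm{dom}(X_1)$ with $b'$ a block of $X_2$. $p\trianglelefteq q$ means every block of $p$ is of the form $b\cap\mathrm{dom}(p)$ for some block $b$ of $q$. For $s\in(\mathbb{N})$, $X\in(\omega)^\omega$ with $s\sqsubseteq X$, $(s,X)^\omega=\{Y\in(\omega)^\omega: s\trianglelefteq Y\wedge Y\sqsubseteq X\}$. A set $C\subseteq(\omega)^\omega$ is completely dual-Ramsey if for every such $(s,Y)^\omega$ there is $X\in(s,Y)^\omega$ with $(s,X)^\omega\subseteq C$ or $(s,X)^\omega\cap C=\emptyset$; it is completely dual-Ramsey null if always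 the second alternative can be achieved. $\mathfrak{H}$ is the dual-shattering cardinal, which equals the additivity of the ideal of completely dual-Ramsey null sets: the least cardinal $\kappa$ such that some union of $\kappa$ completely dual-Ramsey null sets is not completely dual-Ramsey null. *)

(* Defs.v *)
From mathcomp Require Import all_boot.
From mathcomp Require Import boolp classical_sets functions cardinality.

Set Implicit Arguments.
Unset Strict Implicit.
Unset Printing Implicit Defensive.

Local Open Scope classical_set_scope.
Local Open Scope card_scope.

(* A family of subsets of omega, to be read as its set of blocks. *)
Definition blocks := set (set nat).

Definition dom (X : blocks) : set nat := cover X id.

(* [partition X id A] says that the members of [X] are nonempty, pairwise
   disjoint, and have union [A]. *)
Definition partial_partition (X : blocks) : Prop := partition X id (dom X).

(* The set (omega)^omega. *)
Definition infinite_partitions : set blocks :=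
  [set X | partition X id [set: nat] /\ infinite_set X].

(* The set (N). *)
Definition finite_segments : set blocks :=
  [set s | partial_partition s /\ exists n, dom s = `I_n].

(* X1 is coarser than X2, for partial partitions with possibly different
   domains. *)
Definition coarser (X1 X2 : blocks) : Prop :=
  forall b, X1 b ->
    exists2 S, S `<=` X2 & b `&` dom X2 = \bigcup_(c in S) (c `&` dom X1).

(* q extends p: every block of p is the trace on dom p of a block of q. *)
Definition segment (p q : blocks) : Prop :=
  forall b, p b -> exists2 c, q c & b = c `&` dom p.

(* The dual Ellentuck neighbourhood (s, X)^omega. *)
Definition nbhd (s X : blocks) : set blocks :=
  [set Y | [/\ infinite_partitions Y, segment s Y & coarser Y X]].

Definition completely_dual_Ramsey (C : set blocks) : Prop :=
  C `<=` infinite_partitions /\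
  forall s Y, finite_segments s -> infinite_partitions Y -> coarser s Y ->
    exists2 X, nbhd s Y X & nbhd s X `<=` C \/ nbhd s X `&` C = set0.

Definition completely_dual_Ramsey_null (C : set blocks) : Prop :=
  C `<=` infinite_partitions /\
  forall s Y, finite_segments s -> infinite_partitions Y -> coarser s Y ->
    exists2 X, nbhd s Y X & nbhd s X `&` C = set0.

(* Cardinals are represented by types, compared through injections. *)
Definition card_leq (K L : Type) : Prop := [set: K] #<= [set: L].
Definition card_lt (K L : Type) : Prop := card_leq K L /\ ~ card_leq L K.

Definition null_unions_fail (K : Type) : Prop :=
  exists2 N : K -> set blocks,
    forall k, completely_dual_Ramsey_null (N k) &
    ~ completely_dual_Ramsey_null (\bigcup_k N k).

(* H has the cardinality of the dual-shattering cardinal, taken as the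
   additivity of the ideal of completely dual-Ramsey null sets.  Repetitions
   allowed in an indexed union do not change the least such cardinal. *)
Definition dual_shattering_cardinal (H : Type) : Prop :=
  null_unions_fail H /\ forall L : Type, null_unions_fail L -> card_leq H L.

(* The generalized Suslin operation A_kappa; [mkseq f n] is
   <f 0, ..., f (n - 1)>. *)
Definition suslin (K : Type) (Q : seq K -> set blocks) : set blocks :=
  \bigcup_(f in [set: nat -> K]) \bigcap_n Q (mkseq f n).

(* Main.v *)
(* A partition with infinitely many blocks is coded by its least-representative
   map, and the neighbourhood (s, X)^omega by [basic p X], the coarsenings of X
   that agree with X below p.  The dual Ellentuck theorem for open sets follows
   by fusion and combinatorial forcing; its pigeonhole principle is the
   Carlson-Simpson theorem on left variable words, obtained from an idempotent
   ultrafilter whose instances all lie in one minimal left ideal of the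
   Stone-Cech compactification of the words.

   Hence every set A has a closed hull D (the points all of whose neighbourhoods
   meet A in a non-null set) with A \ D null.  For the Suslin scheme, let A_s be
   the part of the operation that passes through s, and D_s its hull.  Then
   D_s \ Q_s is null, and so is D_s minus the union of the D_(s k): there are
   fewer than the dual-shattering cardinal many k.  Outside the union of these
   null sets, a point of D_() lies in D_s for all initial segments s of some f,
   hence in the result of the operation. *)

Require Import Defs.
From mathcomp Require Import all_boot.
From mathcomp Require Import boolp classical_sets functions cardinality filter.

Set Implicit Arguments.
Unset Strict Implicit.
Unset Printing Implicit Defensive.

Local Open Scope classical_set_scope.

(** * Products of ultrafilters on a semigroup *)

(** [Zorn_bigcup] also demands the union of the empty chain; applied to the sets whose union with
    [F0] satisfies [Q], that case is just [Q F0]. *)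
Lemma Zorn_above (T : Type) (Q : set (set T)) (F0 : set T) : Q F0 ->
    (forall C : set (set T), C !=set0 -> C `<=` Q -> total_on C subset ->
      Q (\bigcup_(X in C) X)) ->
  exists F, [/\ Q F, F0 `<=` F & forall G, Q G -> F `<=` G -> G = F].
Proof.
move=> QF0 Qcup.
have [C CQ Ctot|A [QA maxA]] := @Zorn_bigcup T [set X | Q (F0 `|` X)].
  have [[X0 CX0]|C0] := pselect (C !=set0); last first.
    rewrite /= bigcup0 ?setU0// => X CX; case: C0; by exists X.
  rewrite /=; have -> : F0 `|` \bigcup_(X in C) X =
      \bigcup_(Y in [set F0 `|` X | X in C]) Y.
    rewrite bigcup_image; apply/seteqP; split=> x.
      case=> [F0x|[X CX Xx]]; first by exists X0 => //; left.
      by exists X => //; right.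
    by case=> X CX [F0x|Xx]; [left|right; exists X].
  apply: Qcup.
  - by exists (F0 `|` X0); exists X0.
  - by move=> _ [X CX <-]; exact: CQ.
  - move=> _ _ [X CX <-] [Y CY <-].
    by have [XY|YX] := Ctot _ _ CX CY; [left|right]; exact: setUS.
exists (F0 `|` A); split=> // G QG AG.
have eqG : F0 `|` G = G by apply/setUidPr => x F0x; apply: AG; left.
have AsubG : A `<=` G by move=> x Ax; apply: AG; right.
apply/seteqP; split=> // x Gx; apply: contrapT => nx.
apply: (maxA G); last by rewrite /= eqG.
by split=> // GA; apply: nx; right; exact: GA.
Qed.

Section Convolution.
Variables (T : Type) (op : T -> T -> T).
Hypothesis opA : associative op.
Implicit Types F G H U : set_system T.

(* On ultrafilters this is the product of the semigroup beta T. *)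
Definition convol F G : set_system T :=
  [set A | F [set s | G [set t | A (op s t)]]].

Lemma convolA F G H : convol (convol F G) H = convol F (convol G H).
Proof.
apply/funext => A; rewrite /convol /=; congr F; apply/funext => s /=.
congr G; apply/funext => t /=; congr H; apply/funext => u /=.
by rewrite opA.
Qed.

Lemma convol_filter F G : Filter F -> Filter G -> Filter (convol F G).
Proof.
move=> FF FG; split.
- by rewrite /convol /=; apply: filterE => s; apply: filterE.
- move=> A B; rewrite /convol /= => FA FB.
  by apply: filterS2 FA FB => s GA GB; apply: filterS2 GA GB.
- move=> A B AB; rewrite /convol /=; apply: filterS => s; apply: filterS => t.
  exact: AB.
Qed.

Lemma convol_proper F G : ProperFilter F -> ProperFilter G ->
  ProperFilter (convol F G).
Proof.
move=> FF FG; split; last by apply: convol_filter; exact: filter_filter.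
rewrite /convol /= => /filter_ex[s /filter_ex[]]; by [].
Qed.

Lemma convolS F F' G G' : Filter F' ->
  F `<=` F' -> G `<=` G' -> convol F G `<=` convol F' G'.
Proof.
move=> FF' sF sG A /= /sF; rewrite /convol /=; apply: filterS => s; exact: sG.
Qed.

Lemma proper_bigcup (C : set (set_system T)) : C !=set0 ->
  (forall F, C F -> ProperFilter F) -> total_on C subset ->
  ProperFilter (\bigcup_(F in C) F).
Proof.
move=> [F0 CF0] Cproper Ctot; split.
  by move=> [F CF]; have := Cproper _ CF => ?; exact: filter_not_empty.
split.
- by exists F0 => //; have := Cproper _ CF0 => ?; exact: filterT.
- move=> A B [F CF FA] [G CG GB].
  have := Cproper _ CF => ?; have := Cproper _ CG => ?.
  have [FG|GF] := Ctot _ _ CF CG.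
    by exists G => //; apply: filterI => //; exact: FG.
  by exists F => //; apply: filterI => //; exact: GF.
- move=> A B AB [F CF FA]; exists F => //.
  by have := Cproper _ CF => ?; apply: filterS FA.
Qed.

Lemma ultraC U (A : set T) : UltraFilter U -> ~ U A -> U (~` A).
Proof. by move=> UU nA; have [] := in_ultra_setVsetC A UU. Qed.

(* The maximal filters contained in their own square correspond to the minimal
   closed subsemigroups of beta T, which are singletons. *)
Lemma idempotent_ultrafilter F0 : ProperFilter F0 -> F0 `<=` convol F0 F0 ->
  exists e, [/\ UltraFilter e, F0 `<=` e & e `<=` convol e e].
Proof.
move=> F0P F0idem.
have [|C C0 CQ Ctot|F [[FP Fidem] F0F Fmax]] :=
    @Zorn_above _ [set F | ProperFilter F /\ F `<=` convol F F] F0.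
- by [].
- have PC : ProperFilter (\bigcup_(F in C) F).
    by apply: proper_bigcup => // F /CQ[].
  split=> // A [F CF FA]; have [FP Fidem] := CQ _ CF.
  by apply: (convolS (F := F) (G := F)) (Fidem _ FA) => B FB; exists F.
have [V [VU FV]] := ultraFilterLemma FP.
have VP : ProperFilter V by exact: ultra_proper.
(* With S the closed semigroup of ultrafilters above [F], the filter [convol F V] describes the
   closed subsemigroup S V; minimality of S gives S V = S. *)
have FVF : convol F V = F.
  apply: Fmax; last first.
    by move=> A /Fidem; exact: convolS.
  split; first exact: convol_proper.
  have FVFFV : convol F V `<=` convol F (convol F V).
    by rewrite -convolA; apply: convolS => //; apply: convol_filter.
  rewrite /= convolA => A /FVFFV; apply: convolS => // {}A /FVFFV.
  exact: convolS.
pose stab (A : set T) := [set s | V [set t | A (op s t)]].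
(* The filter of {u in S : u V = V}, a closed subsemigroup that is nonempty because S V = S. By
   minimality it is all of S, so V V = V. *)
pose G := [set C | exists B A, [/\ F B, V A & B `&` stab A `<=` C]].
have FG : F `<=` G.
  by move=> B FB; exists B, setT; split=> [||x []] //; exact: filterT.
have GV A : V A -> G (stab A).
  by move=> VA; exists setT, A; split=> [||x []] //; exact: filterT.
have GF : Filter G.
  split.
  - by apply: FG; exact: filterT.
  - move=> C C' [B [A [FB VA sC]]] [B' [A' [FB' VA' sC']]].
    exists (B `&` B'), (A `&` A'); split; [exact: filterI|exact: filterI|].
    move=> x [[Bx B'x] AA']; split.
      by apply: sC; split=> //; apply: filterS AA' => t [].
    by apply: sC'; split=> //; apply: filterS AA' => t [].
  - move=> C D CD [B [A [FB VA sC]]]; exists B, A; split=> //.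
    exact: subset_trans CD.
have GP : ProperFilter G.
  split=> // -[B [A [FB VA sC]]].
  have : V (~` A).
    apply: FV; rewrite -FVF; apply: filterS FB => x Bx.
    by apply: ultraC => xA; apply: (sC x).
  by move=> VnA; apply: (filter_not_empty V); rewrite -(setICr A); exact: filterI.
have GG : G = F.
  apply: Fmax => //; split=> // C [B [A [FB VA sC]]].
  have GGF := convol_filter GF GF.
  apply: filterS sC _; apply: filterI.
    exact: convolS (Fidem _ FB).
  rewrite /convol /=; apply: filterS (GV _ VA) => s sA.
  apply: filterS (GV _ sA) => t; rewrite /stab /=; apply: filterS => u /=.
  by rewrite opA.
have VV : V `<=` convol V V.
  by move=> A /GV; rewrite GG => /FV.
exists V; split=> //; exact: subset_trans FV.
Qed.

(** The ultrafilters above such a filter form a closed left ideal of beta T; maximal proper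
    invariant filters correspond to minimal left ideals. *)
Definition invariant_filter F := forall s A, F A -> F [set t | A (op s t)].

Lemma maximal_invariant_filter : inhabited T -> exists F,
  [/\ ProperFilter F, invariant_filter F &
   forall G, ProperFilter G -> invariant_filter G -> F `<=` G -> G = F].
Proof.
case=> t0.
have [|C C0 CQ Ctot|F [[FP Finv] _ Fmax]] :=
    @Zorn_above _ [set F | ProperFilter F /\ invariant_filter F] [set setT].
- split; last by move=> s _ ->.
  split; first by move=> /= E; have : [set: T] t0 by []; rewrite -E.
  split=> //; first by move=> _ _ -> ->; rewrite setIid.
  by move=> A B AB A1; apply/seteqP; split=> // x _; apply: AB; rewrite A1.
- split; first by apply: proper_bigcup => // F /CQ[].
  by move=> s A [F CF FA]; exists F => //; have [_] := CQ _ CF; apply.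
by exists F; split=> // G GP Ginv; exact: Fmax.
Qed.

(* Idempotents of a minimal left ideal are right identities for it. *)
Lemma absorb F f r : ProperFilter F -> invariant_filter F ->
  (forall G, ProperFilter G -> invariant_filter G -> F `<=` G -> G = F) ->
  UltraFilter f -> F `<=` f -> f `<=` convol f f ->
  Filter r -> F `<=` r -> r `<=` convol r f.
Proof.
move=> FP Finv Fmax fU Ff fidem rF Fr A rA.
have fP : ProperFilter f by exact: ultra_proper.
(* The left-hand side is the filter of the left ideal generated by [f], which lies inside the
   minimal one described by [F]. *)
have GF : [set A | forall s, f [set t | A (op s t)]] = F.
  apply: Fmax.
  - have [t0 _] : [set: T] !=set0 by apply: (@filter_ex _ F); exact: filterT.
    split; first by move=> /(_ t0) /=; exact: filter_not_empty.
    split; first by move=> s /=; exact: filterE.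
      by move=> B C fB fC s; apply: filterS2 (fB s) (fC s) => t.
    by move=> B C BC fB s; apply: filterS (fB s) => t; exact: BC.
  - move=> s B fB t /=; have := fB (op s t); apply: filterS => u /=.
    by rewrite opA.
  - by move=> B FB s; apply: Ff; exact: Finv.
(* It suffices that this set lies in [F], that is, in every product s f; there it follows from (s f)
   f = s f. *)
have : r [set x | A x -> f [set t | A (op x t)]].
  apply: Fr; rewrite -GF => s /=.
  have [fA|fA] := pselect (f [set t | A (op s t)]); last first.
    by move/ultraC : fA; apply: filterS => t nA /nA.
  have := fidem _ fA; rewrite /convol /=; apply: filterS => t ft _.
  by apply: filterS ft => u /=; rewrite opA.
by move=> rA'; apply: filterS2 rA rA' => x Ax; apply.
Qed.

End Convolution.

(** * The Carlson-Simpson theorem *)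

Section CarlsonSimpson.
Variable A : finType.

Definition instance (a : A) : seq (option A) -> seq A := map (odflt a).

Definition left_variable : set (seq (option A)) :=
  [set l | ohead l = Some None].

(* In beta of the variable words, an idempotent [e] of left variable words
   whose instances [e(a)] lie in one minimal left ideal; [r] is any member of
   that ideal.  Minimal left ideals are closed under prefixing, so the
   left variable words [x u] have all their instances [a u] where wanted. *)
Lemma left_variable_ultrafilter : exists r e, [/\ UltraFilter r, UltraFilter e,
  e left_variable,
  forall a C, r C -> r [set w | e [set l | C (w ++ instance a l)]] &
  forall a b C, e [set l | C (instance a l)] ->
    e [set l | e [set l' | C (instance a l ++ instance b l')]]].
Proof.
have [|F [FP Finv Fmax]] := @maximal_invariant_filter _ (@cat A).
  exact: inhabits [::].
(* An ultrafilter above [G] concentrates on left variable words, and each of its instances extends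
   [F], hence lies in the minimal left ideal. *)
pose G : set_system (seq (option A)) := filter_from F
  (fun B => [set l | left_variable l /\ forall a, B (instance a l)]).
have GF : Filter G.
  apply: filter_from_filter; first by exists setT; exact: filterT.
  move=> B B' FB FB'; exists (B `&` B'); first exact: filterI.
  by move=> l [vl Bl]; split; split=> // a; have [] := Bl a.
have GP : ProperFilter G.
  apply: filter_from_proper => // B FB.
  have /filter_ex[u uB] : F [set u | forall a, B (a :: u)].
    by apply: filter_forall => a; exact: (Finv [:: a]).
  exists (None :: map Some u); split=> // a.
  by rewrite /instance /= -map_comp (eq_map (g := id)) ?map_id.
have GG : G `<=` convol cat G G.
  move=> C [B FB BC]; exists B => // l [vl Bl] /=.
  exists (B `&` [set u | forall a, B (instance a l ++ u)]).
    by apply: filterI => //; apply: filter_forall => a; exact: Finv.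
  move=> l' [vl' Bl']; apply: BC; split.
    by case: l vl {Bl Bl'}.
  by move=> a; rewrite /instance map_cat; have [_] := Bl' a; exact.
have [e [eU Ge ee]] := idempotent_ultrafilter (@catA _) GP GG.
have [r [rU Fr]] := ultraFilterLemma FP.
pose ev a : set_system (seq A) := [set C | e [set l | C (instance a l)]].
have evU a : UltraFilter (ev a).
  split.
    split; first exact: filter_not_empty.
    split.
    - by rewrite /ev /=; apply: filterE.
    - by move=> C D; rewrite /ev /= => eC eD; apply: filterS2 eC eD.
    - by move=> C D CD; rewrite /ev /=; apply: filterS => l; exact: CD.
  move=> H HP sH; apply/seteqP; split=> // C HC; apply: contrapT => nC.
  have /sH HnC : ev a (~` C) by exact: (@ultraC _ e _ eU nC).
  by apply: (filter_not_empty H); rewrite -(setICr C); exact: filterI.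
have evP a : ProperFilter (ev a) by exact: ultra_proper.
have Fev a : F `<=` ev a.
  by move=> B FB; apply: Ge; exists B => // l [_]; exact.
have evev a : ev a `<=` convol cat (ev a) (ev a).
  move=> C /ee; rewrite /convol /ev /=; apply: filterS => l; apply: filterS.
  by move=> l'; rewrite /= /instance map_cat.
have eL : e left_variable.
  by apply: Ge; exists setT; [exact: filterT|move=> l []].
exists r, e; split=> //.
- move=> a C rC; have rP : ProperFilter r by exact: ultra_proper.
  by have := @absorb _ _ (@catA _) F (ev a) r FP Finv Fmax (evU a) (Fev a) (evev a)
    _ Fr C rC; apply.
- move=> a b C eC.
  by have := @absorb _ _ (@catA _) F (ev b) (ev a) FP Finv Fmax (evU b) (Fev b)
    (evev b) _ (Fev a) C eC; apply.
Qed.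

(** Of [C] and its complement, take the one that is large for [r]. [D] keeps its words whose
    extensions by instances of [e]-almost every [l] stay in it; the last property of [e] returns
    these extensions to [D]. Words of length n are finitely many, so one [l] serves them all. *)
Lemma extendible_words (C : set (seq A)) : exists D : set (seq A),
  [/\ D `<=` C \/ D `<=` ~` C, D !=set0 &
   forall n, exists l, left_variable l /\
     forall w, D w -> size w = n -> forall a, D (w ++ instance a l)].
Proof.
have [r [e [rU eU eL re ee]]] := left_variable_ultrafilter.
have rP : ProperFilter r by exact: ultra_proper.
have eP : ProperFilter e by exact: ultra_proper.
wlog rC : C / r C => [wl|].
  have [/wl//|/wl[D [DC D0 Dl]]] := in_ultra_setVsetC C rU.
  exists D; split=> //; case: DC => DC; first by right.
  by left; rewrite -(setCK C).
pose D := [set w | C w /\ forall a, e [set l | C (w ++ instance a l)]].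
exists D; split.
- by left => w [].
- have : r D; last by move=> /filter_ex.
  by apply: filterI => //; apply: filter_forall => a; exact: re.
- move=> n.
  have /filter_ex[l [vl lD]] : e [set l | left_variable l /\
      forall w : n.-tuple A, D w -> forall a, D (w ++ instance a l)].
    apply: filterI => //; apply: filter_forall => w.
    have [[Cw wC]|nD] := pselect (D w); last exact: filterE.
    suff : e [set l | forall a, D (w ++ instance a l)].
      by apply: filterS => l lD _.
    apply: filter_forall => a; apply: filterI; first exact: wC.
    apply: filter_forall => b.
    have := ee a b [set u | C (w ++ u)] (wC a); apply: filterS => l.
    by apply: filterS => l' /=; rewrite catA.
  exists l; split=> // w Dw sw; exact: (lD (Tuple (introT eqP sw))).
Qed.

Definition fill (g : nat -> A) (o : A + nat) : A :=
  match o with inl a => a | inr j => g j end.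

(* The infinite word [w_0 w_1(x_1) w_2(x_2) ...] is encoded by [x]: [x i] is
   either a letter, or [inr j] with [j] the position where the variable that
   stands at position [i] first occurs. *)
Theorem carlson_simpson (C : set (seq A)) : exists x : nat -> A + nat,
  [/\ forall i j, x i = inr j -> j <= i /\ x j = inr j,
      forall m, exists2 j, m <= j & x j = inr j &
      (forall g j, x j = inr j -> C (mkseq (fill g \o x) j)) \/
      (forall g j, x j = inr j -> ~ C (mkseq (fill g \o x) j))].
Proof.
have [D [DC [w0 Dw0] /choice[l lD]]] := extendible_words C.
(* A left variable word starts with its variable, so the length of the preceding prefix is the
   position where that variable first occurs. *)
pose tag n (o : option A) : A + nat := if o is Some a then inl a else inr n.
pose P := fix P k := if k is k'.+1
  then P k' ++ map (tag (size (P k'))) (l (size (P k'))) else map inl w0.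
have PS k : P k.+1 = P k ++ map (tag (size (P k))) (l (size (P k))) by [].
have headl k : exists l', l (size (P k)) = None :: l'.
  have [+ _] := lD (size (P k)); rewrite /left_variable /=.
  by case: (l _) => //= o l' [->]; exists l'.
have sizeP k : size (P k) < size (P k.+1).
  rewrite PS size_cat size_map; have [l' ->] := headl k.
  by rewrite /= addnS ltnS leq_addr.
have geP k : k <= size (P k) by elim: k => // k IH; exact: leq_ltn_trans (sizeP k).
have PD k g : D (map (fill g) (P k)).
  elim: k => [|k IH]; first by rewrite /= -map_comp map_id.
  rewrite PS map_cat -map_comp.
  rewrite (eq_map (g := odflt (g (size (P k))))); last by case.
  by have [_] := lD (size (P k)); apply=> //; rewrite size_map.
have prefP k m : exists s, P (k + m) = P k ++ s.
  elim: m => [|m [s IH]]; first by exists [::]; rewrite addn0 cats0.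
  by rewrite addnS PS IH -catA; eexists.
(* The default [inr 0] is never read: [P i.+1] has more than [i] entries. *)
pose x i := nth (inr 0) (P i.+1) i.
have nthP k i : i < size (P k) -> nth (inr 0) (P k) i = x i.
  move=> ik; rewrite /x; have [ki|ki] := leqP k i.+1.
    have [s] := prefP k (i.+1 - k); rewrite subnKC// => ->.
    by rewrite nth_cat ik.
  have [s] := prefP i.+1 (k - i.+1); rewrite subnKC 1?ltnW// => ->.
  by rewrite nth_cat geP.
have xP k : x (size (P k)) = inr (size (P k)).
  rewrite -(nthP k.+1)// PS nth_cat ltnn subnn; have [l' ->] := headl k.
  by [].
have xvar i j : x i = inr j -> exists2 k, j = size (P k) & j <= i.
  suff H k : i < size (P k) -> nth (inr 0) (P k) i = inr j ->
      exists2 k, j = size (P k) & j <= i.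
    by rewrite -(nthP _ _ (geP i.+1)); exact/H/geP.
  elim: k => [|k IH].
    by move=> iw; have /mapP[a _ ->] := mem_nth (inr 0) iw.
  rewrite PS size_cat nth_cat;
  case: (ltnP i (size (P k))) => [ik _|ki]; first exact: IH.
  rewrite size_map => il; rewrite (nth_map None) ?ltn_subLR//.
  by case: (nth _ _ _) => //= -[<-]; exists k.
have mkP g k : mkseq (fill g \o x) (size (P k)) = map (fill g) (P k).
  apply: (@eq_from_nth _ (fill g (inr 0))); rewrite ?size_mkseq ?size_map// => i ik.
  by rewrite nth_mkseq// (nth_map (inr 0))//= nthP.
exists x; split.
- by move=> i j /xvar[k -> ki]; split=> //; exact: xP.
- by move=> m; exists (size (P m)).
- by case: DC => DC; [left|right] => g j /xvar[k -> _]; rewrite mkP; exact: DC.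
Qed.

End CarlsonSimpson.

(** * Infinite partitions and fusion *)

(* A partition of omega into infinitely many blocks, coded by the map sending
   each number to the least element of its block. *)
Record ipart := IPart {
  rep :> nat -> nat;
  rep_le : forall n, rep n <= n;
  repK : forall n, rep (rep n) = rep n;
  rep_unbounded : forall m, exists2 n, m <= n & rep n = n }.

Definition coarsens (Z X : ipart) := forall n, Z (X n) = Z n.

Definition basic (p : nat) (X : ipart) : set ipart :=
  [set Z | coarsens Z X /\ forall n, n < p -> Z n = X n].

Lemma coarsens_refl X : coarsens X X. Proof. exact: repK. Qed.

Lemma coarsens_trans Y X Z : coarsens Z Y -> coarsens Y X -> coarsens Z X.
Proof. by move=> ZY YX n; rewrite -ZY YX ZY. Qed.

Lemma coarsens_fixed X Z q : coarsens Z X -> Z q = q -> X q = q.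
Proof.
move=> ZX Zq; apply/eqP; rewrite eqn_leq rep_le /= -[leqLHS]Zq -ZX.
exact: rep_le.
Qed.

Lemma basic_refl p X : basic p X X.
Proof. by split=> //; exact: coarsens_refl. Qed.

Lemma basic_coarsens p X Z : basic p X Z -> coarsens Z X.
Proof. by case. Qed.

Lemma basic_trans p X Y Z : basic p X Y -> basic p Y Z -> basic p X Z.
Proof.
move=> [YX eYX] [ZY eZY]; split; first exact: coarsens_trans YX.
by move=> n np; rewrite eZY// eYX.
Qed.

Lemma basic_le p q X Z : p <= q -> basic q X Z -> basic p X Z.
Proof.
by move=> pq [ZX eZX]; split=> // n np; apply: eZX; exact: leq_trans pq.
Qed.

(* The blocks of W that meet [0, p) are split again as in X; what they contain
   beyond the X-blocks meeting [0, p) is given to one of the pieces. *)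
Lemma amalgamation p X W : coarsens W X ->
  exists2 W', basic p X W' &
    forall S, coarsens S W' -> (forall n, n < p -> S n = W n) -> basic p W S.
Proof.
move=> WX; pose f n := if X n < p then X n else W n.
have WfX n : X (W n) = W n by apply: (coarsens_fixed WX); exact: repK.
have f_le n : f n <= n by rewrite /f; case: ifP => _; exact: rep_le.
have fK n : f (f n) = f n.
  rewrite /f; case: (ltnP (X n) p) => [Xp|pX]; first by rewrite repK Xp.
  by rewrite WfX repK; case: ifP.
have f_unb m : exists2 n, m <= n & f n = n.
  have [n + Wn] := rep_unbounded W (maxn m p).
  rewrite geq_max => /andP[mn pn]; exists n => //.
  by rewrite /f (coarsens_fixed WX Wn) ltnNge pn.
exists (IPart f_le fK f_unb).
  split=> n /=; rewrite /f; first by rewrite repK WX; case: ifP; rewrite ?repK.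
  by move=> np; rewrite (leq_ltn_trans (rep_le _ _) np).
move=> S SW' SW; split=> // n.
have SX : coarsens S X.
  move=> k; rewrite -(SW' k) -(SW' (X k)) /= /f repK WX.
  by case: ifP; rewrite ?repK.
have [Xp|pX] := ltnP (X n) p; last by rewrite -[RHS]SW' /= /f ltnNge pX.
by rewrite -WX -SW// repK SX.
Qed.

Definition hereditary (P : nat -> ipart -> Prop) :=
  forall p X Y, basic p X Y -> P p X -> P p Y.

Definition dense (P : nat -> ipart -> Prop) :=
  forall p X, exists2 Y, basic p X Y & P p Y.

(** Coarsenings have only finitely many possible restrictions to [0, p). These are treated one after
    another: if some [T] realizes the restriction, density is applied to [T] and [amalgamation]
    carries the result back without changing the restriction of the current partition. *)
Lemma dense_uniform P p X : hereditary P -> dense P ->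
  exists Y, basic p X Y /\ forall T, coarsens T Y -> P p T.
Proof.
move=> Pher Pdense.
suff [Y XY YP] : exists2 Y, basic p X Y & forall T, coarsens T Y ->
    forall t : {ffun 'I_p -> 'I_p}, t \in enum {: {ffun 'I_p -> 'I_p}} ->
    (forall i : 'I_p, T i = t i :> nat) -> P p T.
  exists Y; split=> // T TY.
  have Tp (i : 'I_p) : T i < p by exact: leq_ltn_trans (rep_le _ _) (ltn_ord i).
  apply: (YP T TY [ffun i => Ordinal (Tp i)]); first by rewrite mem_enum.
  by move=> i; rewrite ffunE.
elim: (enum _) => [|t s [Y XY YP]]; first by exists X => //; exact: basic_refl.
have [[T TY Tt]|nT] :=
    pselect (exists2 T, coarsens T Y & forall i : 'I_p, T i = t i);
    last first.
  exists Y => // T TY u; rewrite inE => /orP[/eqP ->|us] Tu.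
    by case: nT; exists T.
  exact: YP us Tu.
have [W TW PW] := Pdense p T.
have [W' YW' W'P] := amalgamation p (coarsens_trans (basic_coarsens TW) TY).
exists W'; first exact: basic_trans YW'.
move=> S SW' u; rewrite inE => /orP[/eqP ->|us] Su; last first.
  by apply: YP us Su; exact: coarsens_trans SW' (basic_coarsens YW').
apply: (Pher p W) => //; apply: W'P => // n np.
by case: TW => _ ->//; rewrite (Su (Ordinal np)) (Tt (Ordinal np)).
Qed.

Lemma next_block_subproof (X : ipart) m : exists n, (m <= n) && (X n == n).
Proof. by have [n mn Xn] := rep_unbounded X m; exists n; rewrite mn Xn eqxx. Qed.

Definition next_block (X : ipart) m := ex_minn (next_block_subproof X m).

Lemma next_blockP (X : ipart) m : [/\ m <= next_block X m,
  X (next_block X m) = next_block X m &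
  forall k, m <= k -> X k = k -> next_block X m <= k].
Proof.
rewrite /next_block; case: ex_minnP => n /andP[mn /eqP Xn] nmin; split=> // k mk Xk.
by apply: nmin; rewrite mk Xk eqxx.
Qed.

(** Each stage applies [dense_uniform] at level [p k], then freezes everything up to and including
    the next representative [q k], whence [p k.+1 = (q k).+1]. The limit [Z] has no representatives
    from [m] on other than the [q k]. *)
Lemma fusion (P : nat -> ipart -> Prop) m X : hereditary P -> dense P ->
  exists2 Z, basic m X Z & forall T, coarsens T Z ->
    P m T /\ forall q, m <= q -> Z q = q -> P q.+1 T.
Proof.
move=> Pher Pdense.
have /choice[h hP] : forall pX : nat * ipart, exists Y,
    basic pX.1 pX.2 Y /\ forall T, coarsens T Y -> P pX.1 T.
  by move=> [p Y]; exact: dense_uniform.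
pose st := fix st k := if k is k'.+1
  then let p := (next_block (st k').2 (st k').1).+1 in (p, h (p, (st k').2))
  else (m, h (m, X)).
pose p k := (st k).1; pose Y k := (st k).2; pose q k := next_block (Y k) (p k).
have pS k : p k.+1 = (q k).+1 by [].
have qP k : [/\ p k <= q k, Y k (q k) = q k &
  forall n, p k <= n -> Y k n = n -> q k <= n] by exact: next_blockP.
have YS k : basic (p k.+1) (Y k) (Y k.+1) by have [] := hP (p k.+1, Y k).
have YP k T : coarsens T (Y k) -> P (p k) T.
  by case: k => [|k]; [have [_] := hP (m, X)|have [_] := hP (p k.+1, Y k)]; exact.
have ltp k : p k < p k.+1 by rewrite pS ltnS; have [] := qP k.
have lep k : k <= p k by elim: k => // k IH; exact: leq_ltn_trans (ltp k).
have homop : {homo p : i j / i <= j}.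
  by apply: homo_leq => [//|? ? ?|i]; [exact: leq_trans|exact: ltnW].
have basicY k d : basic (p k) (Y k) (Y (k + d)).
  elim: d => [|d IH]; first by rewrite addn0; exact: basic_refl.
  apply: basic_trans IH _; rewrite addnS; apply: basic_le (YS _).
  by apply: homop; rewrite -addnS leq_addr.
have YE i j n : i <= j -> n < p i -> Y j n = Y i n.
  by move=> ij np; have [_] := basicY i (j - i); rewrite subnKC//; exact.
pose z n := Y n.+1 n.
have zE k n : n < p k -> z n = Y k n.
  move=> nk; have [kn|/ltnW nk'] := leqP k n.+1; first exact: YE.
  by rewrite (YE n.+1 k)//; exact: lep.
have z_le n : z n <= n by exact: rep_le.
have zK n : z (z n) = z n.
  by rewrite (zE n.+1 (z n)) ?repK//; apply: leq_ltn_trans (lep n.+1).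
have zq k : z (q k) = q k.
  rewrite (zE k.+1) ?pS//; have [_ ->] := YS k; rewrite ?pS//.
  by have [] := qP k.
have z_unb k : exists2 n, k <= n & z n = n.
  exists (q k); last exact: zq.
  by have [pq _ _] := qP k; exact: leq_trans pq.
pose Z := IPart z_le zK z_unb.
have ZY k : basic (p k) (Y k) Z.
  split=> n /=; last by move=> np; exact: zE.
  rewrite (zE (maxn k n.+1) (Y k n)); last first.
    apply: (leq_ltn_trans (rep_le _ _)); apply: leq_trans (lep _).
    exact: leq_maxr.
  rewrite (zE (maxn k n.+1) n); last first.
    by apply: leq_trans (lep _); exact: leq_maxr.
  by have [+ _] := basicY k (maxn k n.+1 - k); rewrite subnKC ?leq_maxl.
exists Z; first by apply: basic_trans (ZY 0); have [] := hP (m, X).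
move=> T TZ; split.
  by apply: (YP 0); exact: coarsens_trans TZ (basic_coarsens (ZY 0)).
move=> r mr Zr.
have [k [pk kp]] : exists k, p k <= r /\ r < p k.+1.
  have [k rk kmin] := ex_minnP (ex_intro (fun k => r < p k) _ (lep r.+1)).
  case: k rk kmin => [|k] rk kmin; first by move: rk; rewrite ltnNge mr.
  exists k; split=> //; rewrite leqNgt; apply/negP => /kmin.
  by rewrite ltnn.
have -> : r = q k.
  have [_ _ qmin] := qP k; apply/eqP; rewrite eqn_leq -ltnS -pS kp /=.
  by apply: qmin => //; exact: coarsens_fixed (basic_coarsens (ZY k)) Zr.
by rewrite -pS; apply: YP; exact: coarsens_trans TZ (basic_coarsens (ZY _)).
Qed.

(** * Pigeonhole principle for the first new block *)

Lemma new_blocks_enumeration (Z : ipart) p : exists e idx : nat -> nat,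
  [/\ forall j, p <= e j /\ Z (e j) = e j, {homo e : i j / i < j} &
   forall q, p <= q -> Z q = q -> e (idx q) = q].
Proof.
pose e := fix e j := if j is j'.+1 then next_block Z (e j').+1 else next_block Z p.
have e_lt j : e j < e j.+1 by have [] := next_blockP Z (e j).+1.
have Ze j : Z (e j) = e j.
  by case: j => [|j]; [have [] := next_blockP Z p|have [] := next_blockP Z (e j).+1].
have homoe : {homo e : i j / i < j}.
  by apply: homo_ltn => [y x z|]; [exact: ltn_trans|exact: e_lt].
have lee j : j <= e j by elim: j => // j IH; exact: leq_ltn_trans (e_lt j).
have pe j : p <= e j.
  elim: j => [|j IH]; first by have [] := next_blockP Z p.
  by apply: leq_trans IH _; exact: ltnW.
have /choice[idx idxP] q : exists j, p <= q -> Z q = q -> e j = q.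
  have [[pq Zq]|npq] := pselect (p <= q /\ Z q = q); last first.
    by exists 0 => pq Zq; case: npq.
  have [j qj jmin] := ex_minnP (ex_intro (fun j => q <= e j) _ (lee q)).
  exists j => _ _; apply/eqP; rewrite eqn_leq qj andbT.
  case: j qj jmin => [|j] qj jmin; first by have [_ _] := next_blockP Z p; exact.
  have [_ _] := next_blockP Z (e j).+1; apply=> //.
  by rewrite ltnNge; apply/negP => /jmin; rewrite ltnn.
by exists e, idx; split.
Qed.

(* The new blocks of Z (those disjoint from [0, p)), in increasing order, are
   merged according to the infinite word y: the i-th one is joined to the block
   of a letter a < p, or to the j-th new block. *)
Lemma merge_along (Z : ipart) p e idx (y : nat -> 'I_p + nat) :
  (forall j, p <= e j /\ Z (e j) = e j) -> {homo e : i j / i < j} ->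
  (forall q, p <= q -> Z q = q -> e (idx q) = q) ->
  (forall i j, y i = inr j -> j <= i /\ y j = inr j) ->
  (forall m, exists2 j, m <= j & y j = inr j) ->
  exists Y : ipart, basic p Z Y /\ forall n, p <= Z n ->
    Y n = match y (idx (Z n)) with inl a => Z a | inr j => e j end.
Proof.
move=> eP homoe eidx yP y_unb.
have homole : {homo e : i j / i <= j} by exact: ltnW_homo.
have lee j : j <= e j.
  by elim: j => // j IH; exact: leq_ltn_trans IH (homoe _ _ (ltnSn j)).
have injE i j : e i = e j -> i = j.
  by case: (ltngtP i j) => // /homoe + E; rewrite E ltnn.
have idxe j : idx (e j) = j by have [pe Ze] := eP j; apply: injE; exact: eidx.
pose f n := if Z n < p then Z n
  else match y (idx (Z n)) with inl a => Z a | inr j => e j end.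
have f_le n : f n <= n.
  rewrite /f; case: ltnP => [_|pZ]; first exact: rep_le.
  apply: leq_trans (rep_le Z n); case yE: (y _) => [a|j].
    apply: leq_trans pZ; apply: leq_trans (rep_le Z a) _; exact: ltnW.
  by rewrite -[leqRHS](eidx (Z n)) ?repK//; apply: homole; have [] := yP _ _ yE.
have fK n : f (f n) = f n.
  rewrite {2 3}/f; case: ltnP => [Zp|pZ]; first by rewrite /f repK Zp.
  case yE: (y _) => [a|j].
    by rewrite /f repK (leq_ltn_trans (rep_le Z a)).
  have [pe Ze] := eP j; have [_ yj] := yP _ _ yE.
  by rewrite /f Ze ltnNge pe /= idxe yj.
have f_unb m : exists2 n, m <= n & f n = n.
  have [j mj yj] := y_unb m; exists (e j); first exact: leq_trans (lee j).
  by have [pe Ze] := eP j; rewrite /f Ze ltnNge pe /= idxe yj.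
exists (IPart f_le fK f_unb); split; last first.
  by move=> n pZ /=; rewrite /f ltnNge pZ.
split=> n /=; first by rewrite /f repK.
by move=> np; rewrite /f (leq_ltn_trans (rep_le Z n)).
Qed.

(** The blocks of [Z] preceding the first new block of [T] are joined in [T] to old blocks, which
    spells a finite word over the old elements. Words are coloured by whether [A] holds of the
    corresponding partition, and [Z'] merges the new blocks along a homogeneous infinite word. *)
Lemma block_pigeonhole (A R : nat -> ipart -> Prop) p Z :
  hereditary A -> hereditary R ->
  (forall T, coarsens T Z -> forall q, p <= q -> Z q = q ->
    A q.+1 T \/ R q.+1 T) ->
  exists2 Z', basic p Z Z' &
    (forall T, basic p Z' T -> A (next_block T p).+1 T) \/
    (forall T, basic p Z' T -> R (next_block T p).+1 T).
Proof.
(* For p = 0 the alphabet would be empty; then the first new block is always that of 0, and a single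
   instance of [AR] decides. *)
move=> Aher Rher AR; case: p => [|p] in AR *.
  have next0 T : next_block T 0 = 0.
    have [_ _ nmin] := next_blockP T 0; apply/eqP; rewrite -leqn0; apply: nmin => //.
    by apply/eqP; rewrite -leqn0; exact: rep_le.
  have rep0 (X : ipart) n : n < 1 -> X n = 0.
    by case: n => // _; apply/eqP; rewrite -leqn0; exact: rep_le.
  have basic1 T : basic 0 Z T -> basic 1 Z T.
    by move=> [TZ _]; split=> // n n0; rewrite !rep0.
  exists Z; first exact: basic_refl.
  have [AZ|RZ] := AR Z (coarsens_refl Z) 0 (leqnn 0) (rep0 Z 0 isT).
    by left=> T /basic1 TZ; rewrite next0; exact: Aher TZ AZ.
  by right=> T /basic1 TZ; rewrite next0; exact: Rher TZ RZ.
have [e [idx [eP homoe eidx]]] := new_blocks_enumeration Z p.+1.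
have homole : {homo e : i j / i <= j} by exact: ltnW_homo.
have injE i j : e i = e j -> i = j.
  by case: (ltngtP i j) => // /homoe + E; rewrite E ltnn.
have idxe j : idx (e j) = j by have [pe Ze] := eP j; apply: injE; exact: eidx.
(* [t w] joins the first [size w] new blocks to the old blocks named by the letters of [w] and
   leaves the later ones alone. *)
have /choice[t tP] w : exists Y : ipart, basic p.+1 Z Y /\
    forall n, p < Z n -> Y n =
      if idx (Z n) < size w then Z (nth ord0 w (idx (Z n)) : 'I_p.+1) else Z n.
  pose y i : 'I_p.+1 + nat := if i < size w then inl (nth ord0 w i) else inr i.
  have [||Y [ZY YE]] := merge_along eP homoe eidx (y := y).
  - by move=> i j; rewrite /y; case: ifP => // iw -[<-]; rewrite iw.
  - move=> m; exists (maxn m (size w)); first exact: leq_maxl.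
    by rewrite /y ltnNge leq_maxr.
  exists Y; split=> // n pZ; rewrite YE// /y; case: ifP => // _.
  by rewrite eidx ?repK.
have [x [xP x_unb xC]] :=
  carlson_simpson [set w | A (e (size w)).+1 (t w)].
have [Z' [ZZ' Z'E]] := merge_along eP homoe eidx xP x_unb.
exists Z' => //.
have next_word T : basic p.+1 Z' T -> exists g j, [/\ x j = inr j,
    next_block T p.+1 = e j &
    basic (e j).+1 (t (mkseq (fill g \o x) j)) T].
  move=> Z'T; have ZT := basic_trans ZZ' Z'T.
  have [TZ eTZ] := ZT; have [TZ' eTZ'] := Z'T.
  have [pq Tq qmin] := next_blockP T p.+1; set q := next_block T p.+1 in pq Tq qmin *.
  have Z'q := coarsens_fixed TZ' Tq; have Zq := coarsens_fixed TZ Tq.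
  set j := idx q.
  have ej : e j = q by exact: eidx.
  have xj : x j = inr j.
    move: (Z'E q); rewrite Zq pq Z'q -/j => /(_ isT).
    case xE: (x j) => [a|l].
      move=> qE; have := leq_ltn_trans (rep_le Z a) (ltn_ord a).
      by rewrite -qE ltnS leqNgt pq.
    by rewrite -ej => /injE ->.
  (* For l < j the value [T (e l)] is old, since [q] is the first new representative of [T]; the
     default [ord0] can occur only from j on. *)
  pose g l := insubd (ord0 : 'I_p.+1) (T (e l)).
  have gE l : l < j -> g l = T (e l) :> nat.
    move=> lj; rewrite /g val_insubd ifT// ltnNge; apply/negP => pT.
    have := qmin _ pT (repK _ _); rewrite leqNgt => /negP; apply.
    by rewrite -ej; apply: leq_ltn_trans (rep_le _ _) (homoe _ _ lj).
  exists g, j; split=> //.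
  have := tP (mkseq (fill g \o x) j); rewrite size_mkseq; set Y := t _.
  move=> [[YZ eYZ] YE].
  have TY n : T (Y n) = T n.
    have [Zp|pZ] := ltnP (Z n) p.+1; first by rewrite -YZ eYZ// repK TZ.
    rewrite YE//; case: ifP => ij; last by rewrite TZ.
    rewrite nth_mkseq//= TZ -[RHS]TZ' Z'E//.
    case xE: (x _) => [a|l] /=; first by rewrite TZ.
    have [li _] := xP _ _ xE.
    by rewrite gE ?repK//; exact: leq_ltn_trans li ij.
  have small k : k < p.+1 -> Z k = k -> T k = k by move=> kp Zk; rewrite eTZ.
  split=> // n nq; rewrite -TY.
  have [Zp|pZ] := ltnP (Z n) p.+1.
    by rewrite -YZ eYZ// repK; apply: small => //; exact: repK.
  rewrite YE//; case: ifP => ij.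
    apply: small; last exact: repK.
    by apply: leq_ltn_trans (rep_le _ _) _; exact: ltn_ord.
  have Zn : Z n = q.
    apply/eqP; rewrite eqn_leq; apply/andP; split.
      by rewrite -ej; apply: leq_trans (rep_le Z n) _; rewrite -ltnS.
    rewrite -ej -[Z n](eidx (Z n)) ?repK//.
    by apply: homole; rewrite leqNgt ij.
  by rewrite Zn.
have sizew g j : e (size (mkseq (fill g \o x) j)) = e j by rewrite size_mkseq.
case: xC => xC; [left|right] => T /next_word[g [j [xj -> jT]]].
  by apply: Aher jT _; have := xC g j xj; rewrite /= size_mkseq.
apply: Rher jT _; have [] // := AR (t (mkseq (fill g \o x) j)) _ (e j).
- by have [/basic_coarsens] := tP (mkseq (fill g \o x) j).
- by have [] := eP j.
- by have [] := eP j.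
by move=> Aj; case: (xC g j xj); rewrite /= size_mkseq.
Qed.

(** * The dual Ellentuck theorem and the ideal of null sets *)

Definition ramsey (C : set ipart) := forall p X, exists2 Y, basic p X Y &
  basic p Y `<=` C \/ basic p Y `<=` ~` C.

Definition null (C : set ipart) := forall p X, exists2 Y, basic p X Y &
  basic p Y `<=` ~` C.

Definition open_set (U : set ipart) :=
  forall X, U X -> exists p, basic p X `<=` U.

Lemma basic_sub p X Y : basic p X Y -> basic p Y `<=` basic p X.
Proof. by move=> XY Z; exact: basic_trans. Qed.

Lemma basic_sub_le p q X : p <= q -> basic q X `<=` basic p X.
Proof. by move=> pq Z; exact: basic_le. Qed.

(* Combinatorial forcing: (p, X) accepts U if basic p X is included in U, and
   rejects U if no (p, Y) with Y in basic p X accepts it. *)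
Lemma open_ramsey U : open_set U -> ramsey U.
Proof.
move=> Uopen.
pose A p X := basic p X `<=` U.
pose R p X := forall Y, basic p X Y -> ~ A p Y.
have Aher : hereditary A.
  by move=> p X Y XY AX; exact: subset_trans (basic_sub XY) AX.
have Rher : hereditary R.
  by move=> p X Y XY RX Z YZ; apply: RX; exact: basic_trans YZ.
(* The second alternative lets rejection pass from one representative of [T] to the next. *)
pose Q p X := A p X \/ forall T, basic p X T -> R (next_block T p).+1 T.
have Qher : hereditary Q.
  move=> p X Y XY [AX|RX]; first by left; exact: Aher AX.
  by right=> T YT; apply: RX; exact: basic_trans YT.
have Qdense : dense Q.
  move=> p X; have [[Y XY AY]|nA] := pselect (exists2 Y, basic p X Y & A p Y).
    by exists Y => //; left.
  (* Fusion gets acceptance or rejection decided past every representative, and the pigeonhole makes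
     the decision uniform at the first new block. Uniform acceptance there puts every [T] in [U], so
     that [(p, Z')] itself accepts. *)
  have [||Z XZ ZAR] := @fusion (fun p X => A p X \/ R p X) p X.
  - move=> q Y Y' YY' [AY|RY]; first by left; exact: Aher AY.
    by right; exact: Rher RY.
  - move=> q Y; have [[Y' YY' AY']|nA'] :=
        pselect (exists2 Y', basic q Y Y' & A q Y').
      by exists Y' => //; left.
    exists Y; first exact: basic_refl.
    by right=> Y' YY' AY'; apply: nA'; exists Y'.
  have [|Z' ZZ' [AZ'|RZ']] := @block_pigeonhole A R p Z Aher Rher.
  - by move=> T TZ q pq Zq; have [_] := ZAR T TZ; apply.
  - exists Z'; first exact: basic_trans ZZ'.
    by left=> T Z'T; apply: (AZ' T Z'T); exact: basic_refl.
  - by exists Z'; [exact: basic_trans ZZ'|right].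
move=> m X; have [Z XZ ZQ] := fusion m X Qher Qdense.
exists Z => //; have [QZ _] := ZQ Z (coarsens_refl Z).
case: QZ => [AZ|RZ]; [by left|right=> T ZT UT].
(* Rejection at arbitrarily large levels contradicts the openness of [U] at [T]. *)
have TR k : exists q, [/\ k <= q, m <= q, T q = q & R q.+1 T].
  elim: k => [|k [q [kq mq Tq Rq]]].
    have [mq Tq _] := next_blockP T m; exists (next_block T m).
    by split=> //; exact: RZ.
  have [qn Tn _] := next_blockP T q.+1; exists (next_block T q.+1).
  split=> //; [exact: leq_ltn_trans qn|exact: leq_trans (ltnW qn)|].
  have TZ := basic_coarsens ZT; have [_ /(_ q mq)] := ZQ T TZ.
  case=> [|AT|]; [exact: coarsens_fixed Tq|by case: (Rq T (basic_refl _ _))|].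
  by apply; exact: basic_refl.
have [p pU] := Uopen T UT; have [q [pq _ _ Rq]] := TR p.
apply: (Rq T (basic_refl _ _)); apply: subset_trans pU.
by apply: basic_sub_le; exact: leqW.
Qed.

(** * The ideal of null sets *)

Lemma nullS (C D : set ipart) : C `<=` D -> null D -> null C.
Proof.
move=> CD nD p X; have [Y XY YD] := nD p X; exists Y => //.
by apply: subset_trans YD _; exact: subsetC.
Qed.

(** The points with a neighbourhood missing [C] form an open set, which is Ramsey. A homogeneous
    neighbourhood inside it misses [C]; one outside it is excluded by the hypothesis. *)
Lemma nowhere_dense_null (C : set ipart) :
  (forall p X, exists q, exists2 Y, basic p X Y & basic q Y `<=` ~` C) ->
  null C.
Proof.
move=> Cnd p X; pose U := [set Y | exists q, basic q Y `<=` ~` C].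
have Uopen : open_set U.
  move=> Y [q YC]; exists q => Z YZ; exists q.
  exact: subset_trans (basic_sub YZ) YC.
have [Z XZ [ZU|ZU]] := open_ramsey Uopen p X.
  by exists Z => // T /ZU[q]; apply; exact: basic_refl.
by have [q [Y ZY YC]] := Cnd p Z; case: (ZU Y ZY); exists q.
Qed.

(** Fusion, where level p takes care of the sets with index at most p; [N j] is avoided past any
    representative q >= j. *)
Lemma null_bigcup_nat (N : nat -> set ipart) :
  (forall j, null (N j)) -> null (\bigcup_j N j).
Proof.
move=> Nnull m X; pose P p X := forall j, j <= p -> basic p X `<=` ~` N j.
have Pher : hereditary P.
  by move=> p Y Z YZ PY j jp; exact: subset_trans (basic_sub YZ) (PY j jp).
have Pdense : dense P.
  move=> p Y; suff [Z YZ ZP] : exists2 Z, basic p Y Z &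
      forall j, j < p.+1 -> basic p Z `<=` ~` N j.
    by exists Z.
  elim: p.+1 => [|k [Z YZ ZP]]; first by exists Y => //; exact: basic_refl.
  have [T ZT TN] := Nnull k p Z; exists T; first exact: basic_trans ZT.
  move=> j; rewrite ltnS leq_eqVlt => /predU1P[->//|jk].
  exact: subset_trans (basic_sub ZT) (ZP j jk).
have [Z XZ ZP] := fusion m X Pher Pdense; exists Z => // T ZT [j _ NT].
have [q + Zq] := rep_unbounded Z (maxn m j); rewrite geq_max => /andP[mq jq].
have [_ /(_ q mq Zq j)] := ZP T (basic_coarsens ZT).
by move=> /(_ (leqW jq) T (basic_refl _ _)).
Qed.

Lemma nullU (C D : set ipart) : null C -> null D -> null (C `|` D).
Proof.
move=> nC nD p X; have [Y XY YC] := nC p X; have [Z YZ ZD] := nD p Y.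
exists Z; first exact: basic_trans YZ.
by move=> T ZT [CT|]; [exact: YC (basic_trans YZ ZT) CT|exact: ZD].
Qed.

(** * The generalized Suslin operation *)

Section Suslin.
Variable K : Type.
Hypothesis null_bigcup : forall N : K -> set ipart,
  (forall k, null (N k)) -> null (\bigcup_k N k).

Lemma null_bigcup_seq (N : seq K -> set ipart) :
  (forall s, null (N s)) -> null (\bigcup_s N s).
Proof.
move=> Nnull.
have sizeN n : forall M : seq K -> set ipart, (forall s, null (M s)) ->
    null (\bigcup_(s in [set s | size s = n]) M s).
  elim: n => [|n IH] M Mnull.
    by apply: nullS (Mnull [::]) => X [[]].
  apply: nullS (null_bigcup (fun k => IH (fun s => M (k :: s)) _)) => //.
  by move=> X [[//|k s] [sn] MX]; exists k => //; exists s.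
by apply: nullS (null_bigcup_nat (fun n => sizeN n N Nnull)) => X [s _ NX];
  exists (size s) => //; exists s.
Qed.

Variable Q : seq K -> set ipart.
Hypothesis Qramsey : forall s, ramsey (Q s).

Let A s : set ipart := [set X | exists f, forall n, Q (s ++ mkseq f n) X].
Let U s : set ipart := [set X | exists p, null (A s `&` basic p X)].

Let A_sub_Q s : A s `<=` Q s.
Proof. by move=> X [f /(_ 0)]; rewrite cats0. Qed.

Let A_rcons s : A s `<=` \bigcup_k A (rcons s k).
Proof.
move=> X [f Xf]; exists (f 0) => //; exists (f \o succn) => n.
by have := Xf n.+1; rewrite cat_rcons /mkseq /= (iotaDl 1 0) -map_comp.
Qed.

Let basic_U s p X : null (A s `&` basic p X) -> basic p X `<=` U s.
Proof.
move=> Anull Y XY; exists p; apply: nullS Anull.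
by apply: setIS; exact: basic_sub.
Qed.

Let openU s : open_set (U s).
Proof. by move=> X [p Anull]; exists p; exact: basic_U. Qed.

(* The complement of [U s] is a closed hull of [A s] up to a null set. *)
Let null_AU s : null (A s `&` U s).
Proof.
apply: nowhere_dense_null => p X.
have [[Y XY [q Anull]]|nU] := pselect (exists2 Y, basic p X Y & U s Y).
  have [Z YZ ZA] := Anull (maxn p q) Y.
  exists (maxn p q), Z.
    by apply: basic_trans XY _; apply: basic_le YZ; exact: leq_maxl.
  move=> T ZT [AT _]; apply: (ZA T ZT); split=> //.
  by apply: (basic_sub_le (leq_maxr p q)); exact: basic_trans ZT.
exists p, X; first exact: basic_refl.
by move=> T XT [_ UT]; apply: nU; exists T.
Qed.

(** A neighbourhood homogeneous for [Q s] lies in [Q s], or misses [Q s] and with it [A s], and is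
    then contained in [U s]. *)
Let null_hullQ s : null (~` U s `\` Q s).
Proof.
apply: nowhere_dense_null => p X; have [Y XY [YQ|YQ]] := Qramsey s p X.
  by exists p, Y => // T /YQ QT [].
exists p, Y => // T YT [nU _]; apply: nU; apply: basic_U YT.
apply: nullS (_ : null set0); first by move=> Z [/A_sub_Q QZ /YQ].
by move=> q Z; exists Z; [exact: basic_refl|move=> ? _ []].
Qed.

(** If no neighbourhood inside [basic p X] is contained in a hull of some [A (rcons s k)], these
    hulls are all null in [basic p X]. Up to null sets they cover [A s] there, so [A s] is null in
    [basic p X], which then lies in [U s]. *)
Let null_hull_rcons s : null (~` U s `\` \bigcup_k ~` U (rcons s k)).
Proof.
apply: nowhere_dense_null => p X.
have [[k [q [Y XY YU]]]|nU] := pselect (exists k q, exists2 Y, basic p X Y &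
    basic q Y `<=` ~` U (rcons s k)).
  by exists q, Y => // T /YU UT [_]; apply; exists k.
exists p, X; first exact: basic_refl.
move=> T XT [+ _]; apply; apply: basic_U XT.
have nullD : null (\bigcup_k (~` U (rcons s k) `&` basic p X)).
  apply: null_bigcup => k; apply: nowhere_dense_null => q Y.
  have [[Z YZ UZ]|nUY] :=
      pselect (exists2 Z, basic q Y Z & U (rcons s k) Z).
    have [r ZU] := openU UZ; exists r, Z => // W /ZU UW [nUW _].
    exact: nUW.
  exists q, Y; first exact: basic_refl.
  move=> Z YZ [_ XZ]; apply: nU; exists k, q, Z => // W ZW UW.
  by apply: nUY; exists W => //; exact: basic_trans ZW.
have nullAU : null (\bigcup_k (A (rcons s k) `&` U (rcons s k))).
  by apply: null_bigcup => k; exact: null_AU.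
apply: nullS (nullU nullD nullAU) => Y [/A_rcons[k _ AY] XY].
have [UY|nUY] := pselect (U (rcons s k) Y); first by right; exists k.
by left; exists k.
Qed.

Lemma suslin_ramsey : ramsey (\bigcup_(f in setT) \bigcap_n Q (mkseq f n)).
Proof.
pose N := \bigcup_s ((~` U s `\` Q s) `|`
  (~` U s `\` \bigcup_k ~` U (rcons s k))).
have Nnull : null N.
  apply: null_bigcup_seq => s.
  by apply: nullU; [exact: null_hullQ|exact: null_hull_rcons].
move=> p X; have [Y XY YN] := nullU Nnull (null_AU [::]) p X.
have [Z YZ ZU] := open_ramsey (@openU [::]) p Y.
exists Z; first exact: basic_trans YZ.
have ZN T : basic p Z T -> ~ (N `|` A [::] `&` U [::]) T.
  by move=> ZT; apply: YN; exact: basic_trans ZT.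
case: ZU => ZU; [right|left] => T ZT.
  move=> [f _ fT]; apply: (ZN T ZT); right; split; last exact: ZU.
  by exists f => n; exact: fT.
have UT := ZU T ZT.
have nNT : ~ N T by move=> NT; apply: (ZN T ZT); left.
have step s : ~ U s T -> Q s T /\ exists k, ~ U (rcons s k) T.
  move=> UsT; split; apply: contrapT => nT; apply: nNT; exists s => //.
    by left.
  by right; split=> // -[k _ kT]; apply: nT; exists k.
(* [k0] shows that [K] is inhabited; it is the default value of the choice below when [T] is in
   [U s]. *)
have [_ [k0 _]] := step _ UT.
have /choice[g gP] s : exists k, ~ U s T -> ~ U (rcons s k) T.
  have [/step[_ [k kT]]|] := pselect (~ U s T); first by exists k.
  by move=> nU; exists k0.
pose r := fix r n := if n is n'.+1 then rcons (r n') (g (r n')) else [::].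
exists (g \o r) => // n _.
have -> : mkseq (g \o r) n = r n.
  by elim: n => // n IH; rewrite mkseqS IH.
have : ~ U (r n) T by elim: n => // n IH; exact: gP.
by case/step.
Qed.

End Suslin.

(** * From partitions to their least-representative maps *)

Definition classes (D : set nat) (f : nat -> nat) : blocks :=
  [set [set n | D n /\ f n = f k] | k in D].

Lemma partition_classes D f : partition (classes D f) id D.
Proof.
split.
- apply/seteqP; split=> [n [_ [k Dk <-] []]//|n Dn].
  by exists [set m | D m /\ f m = f n] => //; exists n.
- move=> _ _ [k Dk <-] [l Dl <-] [n [[_ nk] [_ nl]]].
  by rewrite -nk nl.
- by move=> _ [k Dk <-]; exists k.
Qed.

Lemma dom_classes D f : dom (classes D f) = D.
Proof. by have [] := partition_classes D f. Qed.

Lemma partition_rep s D : partition s id D ->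
  exists2 f, forall n, D n -> [/\ f n <= n, D (f n) & f (f n) = f n] &
    s = classes D f.
Proof.
move=> [sD striv s0].
have /choice[B BP] n : exists b, D n -> s b /\ b n.
  have [Dn|nD] := pselect (D n); last by exists set0.
  by move: Dn; rewrite -sD => -[b sb bn]; exists b.
have BE n b : s b -> b n -> B n = b.
  move=> sb bn; have [|sB Bn] := BP n; first by rewrite -sD; exists b.
  by apply: striv => //; exists n.
have /choice[f fP] n : exists k, D n -> B n k /\ forall l, B n l -> k <= l.
  have [Dn|nD] := pselect (D n); last by exists 0.
  have [_ Bn] := BP n Dn.
  have [k /asboolP Bk kmin] := ex_minnP (ex_intro (fun k => `[< B n k >]) n
    (introT (asboolP _) Bn)).
  by exists k => _; split=> // l Bl; apply: kmin; exact/asboolP.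
have BD n k : D n -> B n k -> D k /\ B k = B n.
  move=> Dn Bk; have [sB _] := BP n Dn; split; last exact: BE.
  by rewrite -sD; exists (B n).
have fB n k : D n -> D k -> f n = f k -> B n = B k.
  move=> Dn Dk fnk; have [Bn _] := fP n Dn; have [Bk _] := fP k Dk.
  by have [_ <-] := BD _ _ Dn Bn; have [_ <-] := BD _ _ Dk Bk; rewrite fnk.
have Bf n k : D n -> D k -> B n = B k -> f n = f k.
  move=> Dn Dk Bnk; have [Bn nmin] := fP n Dn; have [Bk kmin] := fP k Dk.
  by apply/eqP; rewrite eqn_leq nmin ?kmin// -?Bnk// Bnk.
exists f.
  move=> n Dn; have [Bfn fmin] := fP n Dn; have [Dfn BfE] := BD _ _ Dn Bfn.
  by split=> //; [apply: fmin; have [] := BP n Dn|exact: Bf].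
have classE k : D k -> B k = [set n | D n /\ f n = f k].
  move=> Dk; apply/seteqP; split=> [n Bn|n [Dn /(fB _ _ Dn Dk) <-]].
    by have [Dn E] := BD _ _ Dk Bn; split=> //; exact: Bf.
  by have [] := BP n Dn.
apply/seteqP; split=> [b sb|_ [k Dk <-]].
  have [k bk] := s0 b sb; have Dk : D k by rewrite -sD; exists b.
  by exists k => //; rewrite -classE//; exact: BE.
by rewrite -classE//; have [] := BP k Dk.
Qed.

Definition blocks_of (X : ipart) : blocks := classes setT X.

Lemma blocks_ofP (X : ipart) : infinite_partitions (blocks_of X).
Proof.
split; first exact: partition_classes.
have [e [_ [eP homoe _]]] := new_blocks_enumeration X 0.
apply/infiniteP/pcard_leP/injfunPex.
exists (fun j => [set n | [set: nat] n /\ X n = X (e j)]).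
  by move=> j _; exists (e j).
move=> i j _ _ E.
have : [set n | [set: nat] n /\ X n = X (e j)] (e i) by rewrite -E.
move=> [_]; have [_ ->] := eP i; have [_ ->] := eP j.
by case: (ltngtP i j) => // /homoe + eij; rewrite eij ltnn.
Qed.

Lemma infinite_partition_rep Y : infinite_partitions Y ->
  exists X, Y = blocks_of X.
Proof.
move=> [/partition_rep[f fP YE] Yinf].
have f_le n : f n <= n by have [] := fP n.
have fK n : f (f n) = f n by have [] := fP n.
suff f_unb m : exists2 n, m <= n & f n = n by exists (IPart f_le fK f_unb).
apply: contrapT => nf; apply: Yinf.
apply: (@sub_finite_set _ _
  ((fun k => [set n | [set: nat] n /\ f n = f k]) @` `I_m)); last first.
  exact/finite_image/finite_II.
rewrite YE => _ [k _ <-]; exists (f k); last by rewrite fK.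
by rewrite /= ltnNge; apply/negP => mk; apply: nf; exists (f k).
Qed.

Lemma coarser_blocks_of (X Z : ipart) :
  coarser (blocks_of Z) (blocks_of X) <-> coarsens Z X.
Proof.
rewrite /coarser !dom_classes; split=> [ZX n|ZX _ [k _ <-]].
  have [|S SX] := ZX [set m | [set: nat] m /\ Z m = Z n]; first by exists n.
  rewrite setIT => E.
  have : [set m | [set: nat] m /\ Z m = Z n] n by [].
  rewrite E => -[c Sc [cn _]].
  suff : [set m | [set: nat] m /\ Z m = Z n] (X n) by case.
  rewrite E; exists c => //; split=> //.
  by have [l _ cE] := SX _ Sc; move: cn; rewrite -cE /= repK.
exists [set c | blocks_of X c /\ c `<=` [set n | [set: nat] n /\ Z n = Z k]].
  by move=> c [].
rewrite setIT; apply/seteqP; split=> [n [_ nk]|n [c [_ ck] [cn _]]].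
  exists [set m | [set: nat] m /\ X m = X n]; last by [].
  split; first by exists n.
  by move=> m [_ mn]; split=> //; rewrite -ZX mn ZX.
exact: ck.
Qed.

(** A segment determines only the equivalence relation on [0, p), but least representatives of
    points below p stay below p, so this relation fixes their values. *)
Lemma segment_classes p (X Z : ipart) :
  segment (classes `I_p X) (blocks_of Z) <-> forall n, n < p -> Z n = X n.
Proof.
rewrite /segment dom_classes; split=> [sZ|ZX _ [k kp <-]]; last first.
  exists [set n | [set: nat] n /\ Z n = Z k]; first by exists k.
  apply/seteqP; split=> [n [np nk]|n [[_ nk] np]].
    by split=> //; split=> //; rewrite !ZX.
  by split=> //; rewrite -!ZX.
have XZ n k : n < p -> k < p -> X n = X k <-> Z n = Z k.
  move=> np kp; have [|_ [l _ <-] E] := sZ [set n | `I_p n /\ X n = X k].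
    by exists k.
  have kl : Z k = Z l.
    have : [set n | `I_p n /\ X n = X k] k by [].
    by rewrite E => -[[]].
  split=> nk.
    have : [set n | `I_p n /\ X n = X k] n by [].
    by rewrite E kl => -[[]].
  suff : [set n | `I_p n /\ X n = X k] n by case.
  by rewrite E; split=> //; split=> //; rewrite nk kl.
move=> n np; apply/eqP; rewrite eqn_leq; apply/andP; split.
  have Xp : X n < p by exact: leq_ltn_trans (rep_le _ _) np.
  have /(XZ _ _ Xp np) <- : X (X n) = X n by exact: repK.
  exact: rep_le.
have Zp : Z n < p by exact: leq_ltn_trans (rep_le _ _) np.
have /(XZ _ _ Zp np) <- : Z (Z n) = Z n by exact: repK.
exact: rep_le.
Qed.

Lemma nbhd_blocks_of p (X Y : ipart) : basic p X Y ->
  nbhd (classes `I_p X) (blocks_of Y) = blocks_of @` basic p Y.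
Proof.
move=> [YX eYX]; apply/seteqP; split=> [_ [/infinite_partition_rep[Z ->]]|].
  move=> /segment_classes sZ /coarser_blocks_of ZY.
  by exists Z => //; split=> // n np; rewrite sZ// eYX.
move=> _ [Z [ZY eZY] <-]; split; first exact: blocks_ofP.
  by apply/segment_classes => n np; rewrite eZY// eYX.
exact/coarser_blocks_of.
Qed.

Lemma finite_segments_classes p (X : ipart) : finite_segments (classes `I_p X).
Proof.
rewrite /finite_segments /partial_partition /= dom_classes; split; last by exists p.
exact: partition_classes.
Qed.

Lemma coarser_classes p (X : ipart) : coarser (classes `I_p X) (blocks_of X).
Proof.
rewrite /coarser !dom_classes => _ [k kp <-].
exists [set [set n | [set: nat] n /\ X n = X k]]; first by move=> _ ->; exists k.
by rewrite setIT bigcup_set1; apply/seteqP; split=> [n []//|n [[]]].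
Qed.

(** [X0] merges the blocks of [X] that meet [0, p) as [s] prescribes and keeps the others; thus (s,
    X) is replaced by a neighbourhood of the form [basic p X0]. *)
Lemma finite_segment_rep s (X : ipart) :
  finite_segments s -> coarser s (blocks_of X) ->
  exists p X0, coarsens X0 X /\ s = classes `I_p X0.
Proof.
move=> [+ [p sp]]; rewrite /partial_partition /coarser !sp dom_classes.
move=> /partition_rep[f fP sE] sX; exists p.
have fX n : n < p -> f (X n) = f n.
  move=> np; have [|S SX] := sX [set m | `I_p m /\ f m = f n].
    by rewrite sE; exists n.
  rewrite setIT => E.
  have : [set m | `I_p m /\ f m = f n] n by [].
  rewrite E => -[c Sc [cn _]].
  suff : [set m | `I_p m /\ f m = f n] (X n) by case.
  rewrite E; exists c => //; split; last exact: leq_ltn_trans (rep_le _ _) np.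
  by have [l _ cE] := SX _ Sc; move: cn; rewrite -cE /= repK.
pose g n := if X n < p then f (X n) else X n.
have g_le n : g n <= n.
  rewrite /g; case: ifP => [/fP[fle _ _]|_]; last exact: rep_le.
  exact: leq_trans fle (rep_le _ _).
have gK n : g (g n) = g n.
  rewrite {2 3}/g; case: ifP => Xp; last by rewrite /g repK Xp.
  have [_ fp ff] := fP _ Xp.
  by rewrite /g (leq_ltn_trans (rep_le _ _) fp) fX// ff.
have g_unb m : exists2 n, m <= n & g n = n.
  have [n + Xn] := rep_unbounded X (maxn m p); rewrite geq_max => /andP[mn pn].
  by exists n => //; rewrite /g Xn ltnNge pn.
exists (IPart g_le gK g_unb); split; first by move=> n; rewrite /= /g repK.
have gE n : n < p -> g n = f n.
  by move=> np; rewrite /g (leq_ltn_trans (rep_le _ _) np) fX.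
rewrite sE; apply: eq_imagel => k kp /=.
by apply/seteqP; split=> n /= [np E]; split=> //; move: E; rewrite !gE.
Qed.

Lemma blocks_of_inj : injective blocks_of.
Proof.
move=> X Y E.
have XY : coarsens X Y.
  by apply/coarser_blocks_of; rewrite E; exact/coarser_blocks_of/coarsens_refl.
have YX : coarsens Y X.
  by apply/coarser_blocks_of; rewrite E; exact/coarser_blocks_of/coarsens_refl.
have {XY YX E} : rep X = rep Y.
  apply/funext => n; apply/eqP; rewrite eqn_leq; apply/andP; split.
    by rewrite -XY; exact: rep_le.
  by rewrite -YX; exact: rep_le.
case: X => f f1 f2 f3; case: Y => g g1 g2 g3 /= fg; subst g.
by congr IPart; exact: Prop_irrelevance.
Qed.

(** With [P] arbitrary, one translation serves both the Ramsey property and nullness. *)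
Lemma nbhd_basic (P : set (set blocks)) :
  (forall s Y, finite_segments s -> infinite_partitions Y -> coarser s Y ->
    exists2 X, nbhd s Y X & P (nbhd s X)) <->
  (forall p X, exists2 Y, basic p X Y & P (blocks_of @` basic p Y)).
Proof.
split=> [H p X|H s Y sfin /infinite_partition_rep[X ->] sX].
  have [] := H _ _ (finite_segments_classes p X) (blocks_ofP X)
    (@coarser_classes p X).
  move=> Y; rewrite (nbhd_blocks_of (basic_refl p X)) => -[Z XZ <-].
  by rewrite nbhd_blocks_of//; exists Z.
have [p [X0 [X0X ->]]] := finite_segment_rep sfin sX.
have [Z X0Z PZ] := H p X0; exists (blocks_of Z); last by rewrite nbhd_blocks_of.
have : nbhd (classes `I_p X0) (blocks_of X0) (blocks_of Z).
  by rewrite (nbhd_blocks_of (basic_refl p X0)); exists Z.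
move=> [Zinf sZ _]; split=> //; apply/coarser_blocks_of.
exact: coarsens_trans (basic_coarsens X0Z) X0X.
Qed.

Lemma sub_blocks_of C (D : set ipart) :
  blocks_of @` D `<=` C <-> D `<=` blocks_of @^-1` C.
Proof. exact: image_subP. Qed.

Lemma disjoint_blocks_of C (D : set ipart) :
  blocks_of @` D `&` C = set0 <-> D `<=` ~` (blocks_of @^-1` C).
Proof.
split=> [E X DX CX|DC]; last by apply/seteqP; split=> // _ [[X /DC + <-]].
have : (blocks_of @` D `&` C) (blocks_of X) by split=> //; exists X.
by rewrite E.
Qed.

Lemma completely_dual_RamseyE C : C `<=` infinite_partitions ->
  completely_dual_Ramsey C <-> ramsey (blocks_of @^-1` C).
Proof.
move=> Cinf.
have := nbhd_basic [set N | N `<=` C \/ N `&` C = set0] => /= E.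
split=> [[_ /E H]|H].
  move=> p X; have [Y XY YC] := H p X; exists Y => //.
  by case: YC => [/sub_blocks_of|/disjoint_blocks_of]; [left|right].
split=> //; apply/E => p X; have [Y XY YC] := H p X; exists Y => //.
by case: YC => [/sub_blocks_of|/disjoint_blocks_of]; [left|right].
Qed.

Lemma completely_dual_Ramsey_nullE C : C `<=` infinite_partitions ->
  completely_dual_Ramsey_null C <-> null (blocks_of @^-1` C).
Proof.
move=> Cinf.
have := nbhd_basic [set N | N `&` C = set0] => /= E.
split=> [[_ /E H]|H].
  move=> p X; have [Y XY YC] := H p X; exists Y => //.
  exact/disjoint_blocks_of.
split=> //; apply/E => p X; have [Y XY YC] := H p X; exists Y => //.
exact/disjoint_blocks_of.
Qed.

(** A non-null union would make [K] a witness to the failure of additivity, and the minimality of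
    [H] would embed [H] in [K]. *)
Lemma null_bigcup_lt (H K : Type) : dual_shattering_cardinal H -> card_lt K H ->
  forall N : K -> set ipart, (forall k, null (N k)) -> null (\bigcup_k N k).
Proof.
move=> [_ Hmin] [_ nHK] N Nnull.
have preimage_im (D : set ipart) : blocks_of @^-1` (blocks_of @` D) = D.
  by apply/seteqP; split=> [X [Y DY /blocks_of_inj <-]//|X DX]; exists X.
have im_inf (D : set ipart) : blocks_of @` D `<=` infinite_partitions.
  by move=> _ [X _ <-]; exact: blocks_ofP.
apply: contrapT => nN; apply: nHK; apply: Hmin.
exists (fun k => blocks_of @` N k).
  by move=> k; apply/completely_dual_Ramsey_nullE; rewrite ?preimage_im.
rewrite -image_bigcup completely_dual_Ramsey_nullE ?preimage_im//.
Qed.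

Theorem theorem3p5 (H : Type) (hH : dual_shattering_cardinal H)
    (K : Type) (hK : card_lt K H) (Q : seq K -> set blocks)
    (hQ : forall s : seq K, completely_dual_Ramsey (Q s)) :
  completely_dual_Ramsey (suslin Q).
Proof.
have Qinf s : Q s `<=` infinite_partitions by have [] := hQ s.
have Sinf : suslin Q `<=` infinite_partitions.
  by move=> Y [f _ /(_ 0 I)]; exact: Qinf.
apply/(completely_dual_RamseyE Sinf).
apply: (@suslin_ramsey K (null_bigcup_lt hH hK)
  (fun s => blocks_of @^-1` Q s)) => s.
exact/(completely_dual_RamseyE (Qinf s)).
Qed.
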